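(* Let $\{C_r: r\in\mathbb{Q}\cap[0,1]\}$ be a collection of Cantor sets in $(0,1]$ such that, for $r>s$, $C_r\subsetneq C_s$ and no point of $C_r$ is an endpoint of $C_s$. Let $f:[0,1]\to[0,1]$ be a continuous function such that $f(t)=0$ for all $t\in\{0\}\cup C_0$, $f(t)<\min C_0$ for all $t\in[0,1]$, and $f(t)<t$ for all $t\in(0,1]$. Define $F:[0,1]\to 2^{[0,1]}$ by $F(t)=\{f(t)\}$ if $t\notin C_0$ and $F(t)=[0,\sup\{r\in\mathbb{Q}\cap[0,1]: t\in C_r\}]$ if $t\in C_0$. Then $X=\varprojlim\{[0,1],F\}$ is arcwise connected.
   Context: $2^{[0,1]}$ is the collection of nonempty compact subsets of $[0,1]$. A set $C\subseteq[0,1]$ is a Cantor set if it is nonempty, closed, perfect and nowhere dense. A point $x\in C$ is a left endpoint of $C$ if there is $a<x$ with $(a,x)\subseteq[0,1]\setminus C$, and a right endpoint of $C$ if there is $a>x$ with $(x,a)\subseteq[0,1]\setminus C$; an endpoint is a left or right endpoint. With $\omega=\{0,1,2,\dots\}$, the inverse limit is $\varprojlim\{[0,1],F\}=\{(x_0,x_1,\dots)\in[0,1]^{\omega}: x_{i-1}\in F(x_i)\text{ for all } i\ge 1\}$, with the subspace topology from the product. *)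

(* Defs.v *)
From HB Require Import structures.
From mathcomp Require Import all_boot all_order all_algebra.
From mathcomp Require Import all_classical all_reals all_analysis.

Set Implicit Arguments.
Unset Strict Implicit.
Unset Printing Implicit Defensive.

Import Order.TTheory GRing.Theory Num.Theory.
Import numFieldNormedType.Exports.

Local Open Scope classical_set_scope.
Local Open Scope ring_scope.

Definition nowhere_dense (T : topologicalType) (A : set T) : Prop :=
  interior (closure A) = set0.

(* For subsets of [0,1], closed, perfect and nowhere dense mean the same
   relative to [0,1] as relative to the whole line. *)
Definition cantor_set (R : realType) (A : set R) : Prop :=
  [/\ A `<=` `[0, 1], A !=set0, closed A, perfect_set A & nowhere_dense A].

(* The gap next to an endpoint must lie in [0,1]: for closed A, min A is a left
   endpoint iff 0 < min A, and max A is a right endpoint iff max A < 1. *)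
Definition left_endpoint (R : realType) (A : set R) (x : R) : Prop :=
  A x /\ exists2 a : R, a < x & `]a, x[ `<=` `[0, 1] `\` A.

Definition right_endpoint (R : realType) (A : set R) (x : R) : Prop :=
  A x /\ exists2 a : R, x < a & `]x, a[ `<=` `[0, 1] `\` A.

Definition endpoint (R : realType) (A : set R) (x : R) : Prop :=
  left_endpoint A x \/ right_endpoint A x.

Definition is_min (R : realType) (A : set R) (m : R) : Prop :=
  A m /\ lbound A m.

(* Only the values of C on rationals of [0,1], and those of the resulting
   map at points of [0,1], are meaningful. *)
Definition cantor_setmap (R : realType) (C : rat -> set R) (f : R -> R)
    (t : R) : set R :=
  if `[< C 0 t >] then
    `[0, sup [set ratr r | r in [set r : rat | 0 <= r <= 1 /\ C r t]]]%classic
  else [set f t].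

(* [0,1]^nat with the product topology is a subspace of {ptws nat -> R}. *)
Definition invlim01 (R : realType) (F : R -> set R) : set {ptws nat -> R} :=
  [set x | (forall i, 0 <= x i <= 1) /\ (forall i, F (x i.+1) (x i))].

(* A, with the subspace topology, is homeomorphic to [0,1] by a homeomorphism
   h (with inverse g) sending 0 to x and 1 to y. *)
Definition arc_between (R : realType) (T : topologicalType) (x y : T)
    (A : set T) : Prop :=
  exists (h : R -> T) (g : T -> R),
    [/\ {within `[0, 1], continuous h}, {within A, continuous g},
        h @` `[0, 1] = A, (forall t, 0 <= t <= 1 -> g (h t) = t)
      & h 0 = x /\ h 1 = y].

Definition arcwise_connected (R : realType) (T : topologicalType)
    (X : set T) : Prop :=
  forall x y : T, X x -> X y -> x <> y ->
    exists2 A : set T, A `<=` X & arc_between R x y A.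

(* Main.v *)
Require Import Defs.
From HB Require Import structures.
From mathcomp Require Import all_boot all_order all_algebra.
From mathcomp Require Import all_classical all_reals all_analysis.
From mathcomp Require Import lra.

Set Implicit Arguments.
Unset Strict Implicit.
Unset Printing Implicit Defensive.

Import Order.TTheory GRing.Theory Num.Theory.
Import numFieldNormedType.Exports.

Local Open Scope classical_set_scope.
Local Open Scope ring_scope.


(** The space X of the theorem is joined to its zero sequence o by arcs, and
    this is enough: in a Hausdorff space, being joined by an arc inside X is
    transitive between distinct points ([arc_joined_trans]), as one may follow
    the first arc up to its first point on the second one and then switch.

    Let A = C_0.  A point x of X other than o has all its coordinates in A from
    some index on.  Indeed f stays below min A, so a coordinate in A can only
    come from a coordinate in A; and if no coordinate were in A then
    x_i = f^j (x_(i+j)) for all j, which tends to 0 because the iterates of f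
    converge uniformly to 0 on [0,1] ([iter_uniformly_small]).  So x has a
    starting index K: x_K > 0, the coordinates after K are in A, and those
    before K are the images of x_K under the iterates of f
    ([descent_start]).

    For x_(n+1) in A the value of F at x_(n+1) is an interval starting at 0, so
    for 0 <= t <= x_n the point
      (f^n t, ..., f (f t), f t, t, x_(n+1), x_(n+2), ...)
    is again in X ([slide_in_invlim]).  Let t decrease from x_n to 0: the end
    (0, ..., 0, x_(n+1), ...) is where the same motion starts for the index
    n + 1, since f (x_(n+1)) = 0.  Performing these motions one after the other
    for n = K, K + 1, ... leads from x towards o.  The motion is continuous
    also at the limit o, again because the iterates of f are uniformly small
    ([descent_continuous]), and it is injective because the coordinates of x
    from K on are positive while f vanishes on A ([descent_inj]). *)

(** * Arcs in Hausdorff spaces *)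

Section Arcs.
Variable R : realType.

Lemma within_comp (S T U : topologicalType) (A : set S) (B : set T)
    (f : S -> T) (g : T -> U) :
  {within A, continuous f} -> {within B, continuous g} ->
  (forall s, A s -> B (f s)) -> {within A, continuous (g \o f)}.
Proof.
move=> /subspace_continuousP cf /subspace_continuousP cg AB.
apply/subspace_continuousP => s As /=.
have Fs : f @ within A (nbhs s) --> within B (nbhs (f s)).
  move=> W /= WB; have := cf _ As _ WB; rewrite /= !nbhs_simpl /within /=.
  by apply: filterS => t /= Wt At; apply: Wt => //; exact: AB.
exact: (cvg_comp _ _ Fs (cg _ (AB _ As))).
Qed.

(** An injective path on a segment of any length is an arc, because a
    continuous bijection from a compact space to a Hausdorff space is a
    homeomorphism. *)
Lemma arc_of_injection (T : topologicalType) (h : R -> T) (a b : R) :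
  hausdorff_space T -> a < b -> {within `[a, b], continuous h} ->
  (forall s t, a <= s -> s < t -> t <= b -> h s <> h t) ->
  arc_between R (h a) (h b) (h @` `[a, b]).
Proof.
move=> hT ab hc hinj.
have ba0 : 0 < b - a by rewrite subr_gt0.
pose p (t : R) := a + t * (b - a).
have pP t : 0 <= t <= 1 -> a <= p t <= b.
  by move=> /andP[t0 t1]; rewrite /p; nra.
have pc : continuous p.
  move=> t; apply: cvgD; first exact: cvg_cst.
  by apply: cvgM; [exact: cvg_id | exact: cvg_cst].
have hpc : {within `[0, 1], continuous (h \o p)}.
  apply: (within_comp (continuous_subspaceT pc) hc) => t.
  by rewrite /= !in_itv; exact: pP.
have hpi s t : 0 <= s <= 1 -> 0 <= t <= 1 -> h (p s) = h (p t) -> s = t.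
  wlog st : s t / s < t.
    move=> W s01 t01 E; have [H|H|//] := ltgtP s t; first exact: W.
    by apply/esym/W.
  move=> s01 t01 /hinj [];
    [by have := pP _ s01; lra| |by have := pP _ t01; lra].
  by rewrite ltrD2l ltr_pM2r.
pose g y := xget 0 [set t | (0 <= t <= 1) /\ h (p t) = y].
have gK t : 0 <= t <= 1 -> g (h (p t)) = t.
  move=> t01; rewrite /g.
  case: xgetP => [s -> [s01 /hpi]|/(_ t) /=]; first exact.
  by case.
have im : (h \o p) @` `[0, 1] = h @` `[a, b].
  rewrite eqEsubset; split=> y [t]; rewrite /= in_itv /= => tI <-.
    by exists (p t) => //=; rewrite in_itv; exact: pP.
  exists ((t - a) / (b - a)).
    rewrite /= in_itv /= divr_ge0 ?ler_pdivrMr // ?mul1r; lra.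
  by rewrite /= /p divfK ?gt_eqF // addrC subrK.
exists (h \o p), g; split=> //; last first.
  by split; rewrite /= /p ?mul0r ?addr0 // mul1r addrC subrK.
(* Continuity of g, as h is a closed map from a compact to a Hausdorff space: *)
(* preimages of closed sets under g are images of compact sets under h. *)
apply/continuous_closedP => V clV; rewrite -im.
have cK : closed ((h \o p) @` (`[0, 1] `&` V)).
  apply: compact_closed => //; apply: continuous_compact.
    by apply: continuous_subspaceW hpc => t [].
  by apply: compact_closedI => //; exact: segment_compact.
apply/closed_subspaceP; exists ((h \o p) @` (`[0, 1] `&` V)) => //.
rewrite eqEsubset; split=> y [].
  move=> [t [t01 Vt] <-] _; split; last by exists t.
  by rewrite /from_subspace /= gK.
move=> Vg [t t01 ht]; split; last by exists t.
by exists t => //; split=> //; move: Vg; rewrite -ht /from_subspace /= gK.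
Qed.

Definition arc_joined (T : topologicalType) (X : set T) (x y : T) : Prop :=
  exists2 A : set T, A `<=` X & arc_between R x y A.

Lemma arc_between_inj (T : topologicalType) (g : T -> R) (h : R -> T)
    (s t : R) :
  (forall t, 0 <= t <= 1 -> g (h t) = t) -> 0 <= s <= 1 -> 0 <= t <= 1 ->
  h s = h t -> s = t.
Proof. by move=> gK s01 t01 E; rewrite -(gK s) // E gK. Qed.

(** Frees arcs from the parameter interval [0,1] and from the inverse map, so
    that they can be reversed and concatenated. *)
Lemma arc_joinedP (T : topologicalType) (X : set T) (x y : T) :
  hausdorff_space T ->
  arc_joined X x y <-> exists a b h, [/\ a < b :> R,
    {within `[a, b], continuous h},
    (forall s t, a <= s -> s < t -> t <= b -> h s <> h t),
    (forall t, a <= t <= b -> X (h t)) & h a = x /\ h b = y].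
Proof.
move=> hT; split=> [[A AX [h [g [hc gc hA gK [hx hy]]]]]|].
  exists 0, 1, h; split=> //.
    move=> s t s0 st t1 /(arc_between_inj gK); lra.
  by move=> t t01; apply: AX; rewrite -hA; exists t => //=; rewrite in_itv.
move=> [a [b [h [ab hc hi hX [<- <-]]]]].
exists (h @` `[a, b]); last exact: arc_of_injection.
by move=> z [t]; rewrite /= in_itv /= => tab <-; exact: hX.
Qed.

Lemma arc_joined_sym (T : topologicalType) (X : set T) (x y : T) :
  hausdorff_space T -> arc_joined X x y -> arc_joined X y x.
Proof.
move=> hT /(arc_joinedP _ _ _ hT) [a [b [h [ab hc hi hX [hx hy]]]]].
apply/(arc_joinedP _ _ _ hT); exists (- b), (- a), (h \o -%R); split.
- lra.
- apply: (within_comp _ hc).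
    by apply: continuous_subspaceT => t; exact: opp_continuous.
  by move=> t; rewrite /= !in_itv /=; lra.
- by move=> s t bs st ta /esym; apply: hi; lra.
- by move=> t tab; apply: hX; lra.
- by rewrite /= !opprK.
Qed.

(** Follow the first arc up to the first time a at which it meets the second
    one, in its point of parameter b, and continue on the second arc from
    there.  The minimality of a makes the result injective.  The parameter
    interval [0, a + (1 - b)] has positive length because x and z differ. *)
Lemma arc_joined_trans (T : topologicalType) (X : set T) (x y z : T) :
  hausdorff_space T -> x <> z ->
  arc_joined X x y -> arc_joined X y z -> arc_joined X x z.
Proof.
move=> hT xz [A AX [h [g [hc _ hA gK [hx hy]]]]].
move=> [B BX [k [l [kc _ kB lK [ky kz]]]]].
have cB : closed B.
  rewrite -kB; apply: compact_closed => //; apply: continuous_compact => //.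
  exact: segment_compact.
pose S := [set t : R | (0 <= t <= 1) /\ B (h t)].
have cS : compact S.
  suff -> : S = `[0, 1] `&` (h @^-1` B `&` `[0, 1]).
    apply: compact_closedI; first exact: segment_compact.
    rewrite closed_setIS; last exact: interval_closed.
    by move/continuous_closedP : hc; apply.
  by rewrite eqEsubset; split=> t; rewrite /S /= in_itv /= => -[] // ? [].
have S0 : S !=set0.
  exists 1; split; first lra.
  by rewrite hy -ky -kB; exists 0 => //=; rewrite in_itv /=; lra.
have [a] := compact_EVT_min S0 cS (continuous_subspaceT (fun x => cvg_id)).
rewrite inE => -[a01 Ba] amin.
have {}amin t : 0 <= t <= 1 -> B (h t) -> a <= t.
  by move=> t01 Bt; apply: amin; rewrite inE.
move: (Ba); rewrite -[in X in X -> _]kB => -[b /=].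
rewrite in_itv /= => b01 kbha.
pose H t := if t <= a then h t else k (t - a + b).
have Hl t : t <= a -> H t = h t by rewrite /H => ->.
have Hr t : a <= t -> H t = k (t - a + b).
  move=> ta; rewrite /H; case: leP => // ta'.
  have -> : t = a by lra.
  by rewrite subrr add0r.
apply/(arc_joinedP _ _ _ hT); exists 0, (a + (1 - b)), H; split.
(* a = 0 and b = 1 would mean that the arcs meet in x = z *)
- rewrite lt_neqAle; apply/andP; split; last lra.
  apply/negP => /eqP ab; apply: xz; rewrite -hx -kz.
  have -> : 1 = b by lra.
  by rewrite kbha; congr h; lra.
- suff -> : (`[0, a + (1 - b)]%classic =
             `[0, a] `|` `[a, a + (1 - b)] :> set R).
    apply: withinU_continuous; [exact: interval_closed..| |].
      apply: (@subspace_eq_continuous _ _ _ h); last first.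
        by apply: continuous_subspaceW hc => t /=; rewrite !in_itv /=; lra.
      move=> t; rewrite inE /= in_itv /= => /andP[_ ta].
      by rewrite /from_subspace Hl.
    apply: (@subspace_eq_continuous _ _ _ (k \o (fun t => t - a + b))).
      move=> t; rewrite inE /= in_itv /= => /andP[ta _].
      by rewrite /from_subspace Hr.
    apply: (within_comp _ kc); last by move=> t; rewrite /= !in_itv /=; lra.
    apply: continuous_subspaceT => t.
    apply: cvgD; last exact: cvg_cst.
    by apply: cvgB; [exact: cvg_id|exact: cvg_cst].
  rewrite eqEsubset; split=> t /=; rewrite !in_itv /=; last by case; lra.
  by move=> tI; case: (leP t a) => ta; [left|right]; lra.
- move=> s t s0 st tb; case: (leP t a) => ta.
    by rewrite !Hl; [|lra..] => /(arc_between_inj gK); lra.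
  rewrite (Hr t); last lra.
  case: (leP s a) => sa; last first.
    by rewrite Hr; [|lra] => /(arc_between_inj lK); lra.
  rewrite Hl // => E.
  have Bs : B (h s).
    by rewrite E -kB; exists (t - a + b) => //=; rewrite in_itv /=; lra.
  have as_ := amin s ltac:(lra) Bs.
  have sE : s = a by lra.
  by move: E; rewrite sE -kbha => /(arc_between_inj lK); lra.
- move=> t tI; case: (leP t a) => ta.
    rewrite Hl //; apply: AX; rewrite -hA.
    by exists t => //=; rewrite in_itv /=; lra.
  rewrite Hr; last lra.
  by apply: BX; rewrite -kB; exists (t - a + b) => //=; rewrite in_itv /=; lra.
- rewrite Hl; last lra.
  by rewrite Hr; [split=> //; rewrite -kz; congr k|]; lra.
Qed.

Lemma arcwise_connected_from (T : topologicalType) (X : set T) (o : T) :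
  hausdorff_space T -> (forall x, X x -> x <> o -> arc_joined X x o) ->
  arcwise_connected R X.
Proof.
move=> hT jo x y Xx Xy xy.
have [xo|xo] := pselect (x = o).
  rewrite xo; apply: arc_joined_sym => //; apply: jo => // yo.
  by apply: xy; rewrite xo.
have [->|yo] := pselect (y = o); first exact: jo.
apply: (arc_joined_trans hT xy (jo _ Xx xo)).
by apply: arc_joined_sym => //; exact: jo.
Qed.

End Arcs.

(** * Iterates of a map of [0,1] below the diagonal *)

Section Interval_dynamics.
Variables (R : realType) (f : R -> R).
Hypothesis f0 : f 0 = 0.
Hypothesis f_itv : forall t : R, 0 <= t <= 1 -> 0 <= f t <= 1.
Hypothesis f_cont : {within `[0, 1], continuous f}.
Hypothesis f_lt : forall t : R, 0 < t <= 1 -> f t < t.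

Lemma iter_fixed0 n : iter n f 0 = 0.
Proof. by elim: n => //= n ->. Qed.

Lemma iter_itv n t : 0 <= t <= 1 -> 0 <= iter n f t <= 1.
Proof. by move=> t01; elim: n => //= n; exact: f_itv. Qed.

(** On [e,1] the continuous function t - f t has a positive minimum d, so every
    application of f lowers a value in [e,1] by at least d, and a value below e
    stays below e.  Once n d > 1, no value in [e,1] is left. *)
Lemma iter_uniformly_small (e : R) : 0 < e ->
  exists N, forall n t, (N <= n)%N -> 0 <= t <= 1 -> iter n f t < e.
Proof.
move=> e0; have [e1|e1] := ltP 1 e.
  by exists 0%N => n t _ t01; have := iter_itv n t01; lra.
have dc : {within `[e, 1], continuous (fun t => t - f t)}.
  apply: within_continuousB.
    by apply: continuous_subspaceT => t; exact: cvg_id.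
  by apply: continuous_subspaceW f_cont => t; rewrite /= !in_itv /=; lra.
have [c] := EVT_min e1 dc; rewrite in_itv /= => c01 dmin.
set d := c - f c in dmin; have d0 : 0 < d by rewrite subr_gt0 f_lt //; lra.
have step n t : 0 <= t <= 1 -> iter n f t < e \/ iter n f t <= 1 - n%:R * d.
  move=> t01; elim: n => [|n IH] /=; first by right; lra.
  have := iter_itv n t01; set u := iter n f t in IH *; move=> u01.
  have [ue|ue] := ltP u e.
    left; have [->|un0] := eqVneq u 0; first by rewrite f0.
    by have := @f_lt u; rewrite lt_neqAle eq_sym un0 /=; lra.
  right; have := dmin u; rewrite in_itv /= -natr1; lra.
have [N Nd] : exists N : nat, d^-1 < N%:R.
  by exists (Num.bound d^-1); rewrite archi_boundP // invr_ge0 ltW.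
exists N => n t Nn t01; have [//|] := step n t t01.
have : 1 < n%:R * d; last lra.
rewrite -ltr_pdivrMr // mul1r (lt_le_trans Nd) // ler_nat //.
Qed.

Lemma continuous_iter_comp (T : topologicalType) (g : T -> R) n :
  continuous g -> (forall t, 0 <= g t <= 1) -> continuous (iter n f \o g).
Proof.
move=> gc g01; elim: n => [//|n IH] t.
have gT : (iter n f \o g) @ t --> within `[0, 1] (nbhs (iter n f (g t))).
  move=> W WB; have := IH t _ WB; rewrite /= !nbhs_simpl.
  by apply: (@filterS _ (nbhs t)) => s; apply; rewrite /= in_itv /= iter_itv.
apply: (cvg_comp _ _ gT); move/subspace_continuousP : f_cont; apply.
by rewrite /= in_itv /= iter_itv.
Qed.

(** * The infinite concatenation of motions *)

(** The motion of index n is performed, backwards, while the parameter s runs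
    from 2^-(n+1) to 2^-n; [ramp n s] is the proportion of [x n] reached
    then. The dyadic bounds on s are written 1 <= 2^(n+1) s and 2^n s <= 1. *)
Definition ramp n (s : R) : R := Num.max 0 (Num.min 1 (2 ^+ n.+1 * s - 1)).

Lemma ramp_itv n s : 0 <= ramp n s <= 1.
Proof. by rewrite /ramp le_max lexx /= ge_max ler01 ge_min lexx. Qed.

Lemma ramp_continuous n : continuous (ramp n).
Proof.
move=> s; have affine : {for s, continuous (fun s : R => 2 ^+ n.+1 * s - 1)}.
  apply: cvgB; last exact: cvg_cst.
  by apply: cvgM; [exact: cvg_cst|exact: cvg_id].
have cst_at (c : R) : {for s, continuous (fun=> c)} by exact: cvg_cst.
have capped := @continuous_min R R _ _ s (cst_at 1) affine.
exact: (@continuous_max R R _ _ s (cst_at 0) capped).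
Qed.

Lemma ramp0 n s : 2 ^+ n.+1 * s <= 1 -> ramp n s = 0.
Proof. by move=> sn; apply/max_l; rewrite ge_min; apply/orP; right; lra. Qed.

Lemma ramp1 n s : 1 <= 2 ^+ n * s -> ramp n s = 1.
Proof. by rewrite /ramp exprS => sn; rewrite min_l ?max_r //; lra. Qed.

Lemma rampE n s : 1 <= 2 ^+ n.+1 * s -> 2 ^+ n * s <= 1 ->
  ramp n s = 2 ^+ n.+1 * s - 1.
Proof. by rewrite /ramp exprS => sn ns; rewrite min_r ?max_r //; lra. Qed.

Lemma dyadic_mono m n (s : R) :
  (m <= n)%N -> 0 <= s -> 2 ^+ m * s <= 2 ^+ n * s.
Proof. by move=> mn s0; rewrite ler_wpM2r // ler_eXn2l // ltr1n. Qed.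

Lemma dyadic_level K (s : R) : 0 < s -> 2 ^+ K * s <= 1 ->
  exists2 n, (K <= n)%N & 2 ^+ n * s <= 1 /\ 1 < 2 ^+ n.+1 * s.
Proof.
move=> s0 sK; have ex : exists m, 1 < 2 ^+ (K + m) * s.
  exists (Num.bound s^-1); rewrite -ltr_pdivrMr // mul1r.
  have /lt_le_trans : s^-1 < (Num.bound s^-1)%:R.
    by rewrite archi_boundP // invr_ge0 ltW.
  apply; rewrite -natrX ler_nat (leq_trans (ltnW (ltn_expl _ (ltnSn 1)))) //.
  by rewrite leq_exp2l // leq_addl.
case: (ex_minnP ex) => -[|m] m1 mmin; first by move: m1; rewrite addn0; lra.
exists (K + m)%N; first exact: leq_addr.
split; last by rewrite -addnS.
by rewrite leNgt; apply/negP => /mmin; rewrite ltnn.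
Qed.

Section Descent.
Variables (x : nat -> R) (K : nat).
Hypothesis x_itv : forall k, 0 <= x k <= 1.
Hypothesis x_gt0 : forall k, (K <= k)%N -> 0 < x k.
Hypothesis fx0 : forall k, (K < k)%N -> f (x k) = 0.

(** The point (f^n t, ..., f t, t, x_(n+1), x_(n+2), ...) with t = c x_n. *)
Definition slide n (c : R) : nat -> R :=
  fun k => if (k <= n)%N then iter (n - k) f (c * x n) else x k.

(** For 0 < s <= 2^-K at most one term is nonzero: the motions of small
    index have not begun, and those of large index m are completed and give
    f^j (x_m), which is 0 for j > 0.  The sums thus give the sequence
    [slide n (ramp n s)] of the current n by a formula that is visibly
    continuous in s. *)
Definition descent_sum N (s : R) k : R :=
  \sum_(j < N) iter j f (ramp (k + j) s * x (k + j)%N).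

Definition descent (s : R) : nat -> R :=
  fun k => limn (fun N => descent_sum N s k).

Lemma cx_itv c k : 0 <= c <= 1 -> 0 <= c * x k <= 1.
Proof. by move=> c01; have := x_itv k; nra. Qed.

Lemma iter_fx0 k j : (K < k)%N -> (0 < j)%N -> iter j f (x k) = 0.
Proof. by case: j => // j Kk _; rewrite iterSr fx0 // iter_fixed0. Qed.

Lemma descent_sum_slide n N s k :
  (K <= n)%N -> 2 ^+ n * s <= 1 -> 1 <= 2 ^+ n.+1 * s -> (0 < N)%N ->
  descent_sum N s k = if (n < k + N)%N then slide n (ramp n s) k else 0.
Proof.
move=> Kn ns sn N0.
have s0 : 0 <= s.
  by rewrite -(pmulr_rge0 _ (exprn_gt0 n.+1 (ltr0Sn R 1))); lra.
have early m : (m < n)%N -> ramp m s = 0.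
  by move=> mn; apply: ramp0; apply: le_trans ns; exact: dyadic_mono.
have late m : (n < m)%N -> ramp m s = 1.
  by move=> nm; apply: ramp1; apply: le_trans sn _; exact: dyadic_mono.
rewrite /descent_sum /slide; case: (leqP k n) => kn.
  have vanish (j : 'I_N) : (k + j)%N != n ->
      iter j f (ramp (k + j) s * x (k + j)%N) = 0.
    case: ltngtP => // kj _; first by rewrite early // mul0r iter_fixed0.
    rewrite late // mul1r iter_fx0 //; first exact: leq_ltn_trans kj.
    by rewrite -(ltn_add2l k) addn0 (leq_ltn_trans kn).
  case: ifP => nN; last first.
    apply: big1 => j _; apply: vanish; apply/eqP => E.
    by move: nN; rewrite -E ltn_add2l ltn_ord.
  have nkN : (n - k < N)%N by rewrite ltn_subLR.
  rewrite (bigD1 (Ordinal nkN)) //= subnKC // big1 ?addr0 // => j jn.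
  apply: vanish; apply: contra jn => /eqP E; apply/eqP/val_inj => /=.
  by rewrite -E addKn.
case: N N0 => // N _; rewrite ltn_addr // big_ord_recl addn0 late // mul1r /=.
rewrite big1 ?addr0 // => j _.
rewrite late ?mul1r; last exact: ltn_addr.
by rewrite -iterS iter_fx0 // ltn_addr // (leq_ltn_trans Kn).
Qed.

Lemma descent0 : descent 0 = fun=> 0.
Proof.
apply/funext => k; apply: lim_near_cst => //; apply: nearW => N.
by apply: big1 => j _; rewrite ramp0 ?mul0r ?iter_fixed0 // mulr0.
Qed.

Lemma descent_slide n s :
  (K <= n)%N -> 2 ^+ n * s <= 1 -> 1 <= 2 ^+ n.+1 * s ->
  descent s = slide n (ramp n s).
Proof.
move=> Kn ns sn; apply/funext => k; apply: lim_near_cst => //.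
exists n.+1 => // N /= nN; rewrite (descent_sum_slide _ Kn) //.
  by rewrite ltn_addl.
exact: leq_ltn_trans nN.
Qed.

(** A partial sum is either already equal to its limit or still 0; in the latter
    case the limit is the value of an iterate of f of order at least N. *)
Lemma descent_sum_approx (e : R) N s k :
  0 < e -> (forall n t, (N <= n)%N -> 0 <= t <= 1 -> iter n f t < e) ->
  (0 < N)%N -> 0 <= s -> 2 ^+ K * s <= 1 ->
  `|descent_sum N s k - descent s k| < e.
Proof.
move=> e0 small N0 s0 sK.
move: s0; rewrite le_eqVlt => /predU1P[<-|s0].
  rewrite descent0 subr0 /descent_sum big1 ?normr0 // => j _.
  by rewrite ramp0 ?mul0r ?iter_fixed0 // mulr0.
have [n Kn [ns /ltW sn]] := dyadic_level s0 sK.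
rewrite (descent_sum_slide _ Kn) // (descent_slide Kn) //.
case: ltnP => kN; first by rewrite subrr normr0.
rewrite sub0r normrN /slide (leq_trans (leq_addr _ _) kN).
have cx := cx_itv n (ramp_itv n s).
rewrite ger0_norm; last by have := iter_itv (n - k) cx; lra.
by apply: small => //; rewrite leq_subRL // (leq_trans (leq_addr _ _) kN).
Qed.

(** Each coordinate is a uniform limit of continuous functions. *)
Lemma descent_continuous (b : R) : 2 ^+ K * b <= 1 ->
  {within `[0, b], continuous (descent : R -> {ptws nat -> R})}.
Proof.
move=> bK; apply/subspace_continuousP => s; rewrite /= in_itv /= => sb.
apply/pointwise_cvgP => k /=; apply/cvgrPdist_lt => e e0.
have e3 : 0 < e / 3 by lra.
have [N0 small] := iter_uniformly_small e3.
have {}small n t : (N0.+1 <= n)%N -> 0 <= t <= 1 -> iter n f t < e / 3.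
  by move=> /ltnW; exact: small.
have inK t : 0 <= t <= b -> 2 ^+ K * t <= 1.
  move=> tb; apply: le_trans bK; rewrite ler_pM2l ?exprn_gt0 //; lra.
have approx t : 0 <= t <= b ->
    `|descent_sum N0.+1 t k - descent t k| < e / 3.
  by move=> tb; apply: descent_sum_approx => //; [lra | exact: inK].
have cN : continuous (fun t => descent_sum N0.+1 t k).
  apply: continuous_big; first exact: add_continuous.
  move=> j _.
  apply: continuous_iter_comp; last by move=> t; exact/cx_itv/ramp_itv.
  by move=> t; apply: cvgM; [exact: ramp_continuous|exact: cvg_cst].
move/cvgrPdist_lt : (cN s) => /(_ _ e3) near_s.
suff : \forall t \near within `[0, b] (nbhs s),
  `|descent s k - descent t k| < e by [].
rewrite near_withinE; near=> t; rewrite /= in_itv /= => tb.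
have : `|descent_sum N0.+1 s k - descent_sum N0.+1 t k| < e / 3 by near: t.
move: (approx _ sb) (approx _ tb); rewrite !ltr_norml; lra.
Unshelve. all: by end_near. Qed.

(** At s = 0 all coordinates are 0, but not at t.  For s > 0 let m <= n be
    the indices of the motions performed at t and s.  If m = n,
    then coordinate n, which is an injective function of the parameter during
    that motion, tells s and t apart.  If m < n and coordinate n does not, then
    it is x_n at both times, and coordinate n - 1 is f (x_n) = 0 at s but
    positive at t. *)
Lemma descent_inj s t : 0 <= s -> s < t -> 2 ^+ K * t <= 1 ->
  descent s <> descent t.
Proof.
move=> s0 st tK E; have t0 : 0 < t by lra.
have [m Km [mt tm]] := dyadic_level t0 tK.
have xm := x_gt0 Km; have xm1 := x_gt0 (leqW Km).
have Et := descent_slide Km mt (ltW tm); rewrite Et in E.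
have cm : 0 < ramp m t by rewrite rampE //; [lra | exact: ltW].
have tpos k : (m <= k)%N -> 0 < slide m (ramp m t) k.
  rewrite /slide leq_eqVlt => /predU1P[<-|mk].
    by rewrite leqnn subnn /= mulr_gt0.
  by rewrite leqNgt mk /= x_gt0 // (leq_trans Km (ltnW mk)).
move: s0; rewrite le_eqVlt => /predU1P[s0|s0].
  by have := tpos m (leqnn m); rewrite -E -s0 descent0 ltxx.
have sK : 2 ^+ K * s <= 1.
  by apply: le_trans tK; rewrite ler_pM2l ?exprn_gt0 //; lra.
have [n Kn [ns sn]] := dyadic_level s0 sK.
rewrite (descent_slide Kn ns (ltW sn)) in E.
have xn := x_gt0 Kn.
have : (m <= n)%N.
  rewrite leqNgt; apply/negP => nm.
  have : 2 ^+ n.+1 * s < 2 ^+ m * t; last lra.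
  apply: (@le_lt_trans _ _ (2 ^+ m * s)).
    by apply: dyadic_mono => //; lra.
  by rewrite ltr_pM2l ?exprn_gt0.
have En := congr1 (fun g => g n) E; rewrite {1}/slide leqnn subnn /= in En.
rewrite leq_eqVlt => /predU1P[mn|mn].
  move: mt tm En; rewrite mn /slide leqnn subnn /= => mt tm.
  move=> /(mulIf (lt0r_neq0 xn)).
  rewrite (rampE (ltW sn) ns) (rampE (ltW tm) mt).
  have : 2 ^+ n.+1 * s < 2 ^+ n.+1 * t by rewrite ltr_pM2l ?exprn_gt0.
  lra.
move: En; rewrite {1}/slide leqNgt mn /= -[RHS]mul1r.
move=> /(mulIf (lt0r_neq0 xn)) c1.
case: n mn Kn {ns sn} xn E c1 => // n mn Kn xn E c1.
have := tpos n mn; rewrite -E /slide leqnSn subSnn /= c1 mul1r fx0 ?ltxx //.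
exact: leq_ltn_trans mn.
Qed.

End Descent.
End Interval_dynamics.

(** * Inverse limit of a map with vertical intervals added over a set *)

Section Inverse_limit.
Variables (R : realType) (f : R -> R) (F : R -> set R) (A : set R).
Hypothesis f0 : f 0 = 0.
Hypothesis f_itv : forall t : R, 0 <= t <= 1 -> 0 <= f t <= 1.
Hypothesis f_cont : {within `[0, 1], continuous f}.
Hypothesis f_lt : forall t : R, 0 < t <= 1 -> f t < t.
Hypothesis A_gt0 : forall t, A t -> 0 < t.
Hypothesis f_below_A : forall s t, 0 <= s <= 1 -> A t -> f s < t.
Hypothesis fA : forall t, A t -> f t = 0.
Hypothesis F_notA : forall t, ~ A t -> F t = [set f t].
Hypothesis F_A0 : forall t, A t -> F t 0.
Hypothesis F_A_down : forall t y z, A t -> F t y -> 0 <= z <= y -> F t z.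

Let X : set {ptws nat -> R} := invlim01 F.

Lemma selection t : F t (f t).
Proof.
have [At|nAt] := pselect (A t); first by rewrite fA //; exact: F_A0.
by rewrite F_notA.
Qed.

Lemma zero_in_invlim : X (fun=> 0).
Proof.
split=> i; first by rewrite lexx ler01.
by rewrite -{2}f0; exact: selection.
Qed.

(** Outside A the set-valued map is f, whose values lie below A. *)
Lemma A_next x i : X x -> A (x i) -> A (x i.+1).
Proof.
move=> [x01 xF] Ai; apply: contrapT => nA.
have := xF i; rewrite F_notA //= => xi.
by have := f_below_A (x01 i.+1) Ai; rewrite -xi ltxx.
Qed.

Lemma A_upward x i j : X x -> (i <= j)%N -> A (x i) -> A (x j).
Proof.
move=> Xx /subnKC <- Ai; elim: (j - i)%N => [|n]; first by rewrite addn0.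
by rewrite addnS; exact: A_next.
Qed.

(** Otherwise x k is the value of iterates of f of arbitrarily high order. *)
Lemma meets_A x : X x -> x <> (fun=> 0) -> exists i, A (x i).
Proof.
move=> [x01 xF] x0; apply: contrapT => nA; apply: x0; apply/funext => k.
have xf i : x i = f (x i.+1).
  have := xF i; rewrite F_notA // => Ai.
  by apply: nA; exists i.+1.
have xit j : x k = iter j f (x (k + j)%N).
  by elim: j => [|j IH]; rewrite ?addn0 // addnS iterSr -xf.
apply/eqP; rewrite eq_le; apply/andP; split; last by have := x01 k; lra.
apply/ler_addgt0Pr => e e0; rewrite add0r.
have [N small] := iter_uniformly_small f0 f_itv f_cont f_lt e0.
by rewrite (xit N) ltW // small.
Qed.

(** If n is the first index with [A (x n)], the start is n - 1 when
    x (n - 1) > 0.  When x (n - 1) = 0 = f (x n), the motion of index n - 1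
    would be constant, and the start is n. *)
Lemma descent_start x : X x -> x <> (fun=> 0) -> exists K,
  [/\ 0 < x K, forall k, (K < k)%N -> A (x k) &
      forall k, (k < K)%N -> x k = f (x k.+1)].
Proof.
move=> Xx x0; have exA : exists n, `[< A (x n) >].
  by have [n An] := meets_A Xx x0; exists n; apply/asboolP.
case: (ex_minnP exA) => n /asboolP An nmin.
have below k : (k.+1 < n)%N -> x k = f (x k.+1).
  move=> kn; case: Xx => _ /(_ k); rewrite F_notA // => Ak.
  by have := nmin k.+1; rewrite leqNgt kn => /(_ (introT (asboolP _) Ak)).
have above k : (n <= k)%N -> A (x k) by move=> nk; exact: A_upward An.
case: n An below above {nmin} => [|p] An below above.
  by exists 0%N; split=> //; [exact: A_gt0 | move=> k _; exact: above].
have [xp|xp] := ltP 0 (x p).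
  by exists p; split=> //; move=> k kp; apply: below.
exists p.+1; split; [exact: A_gt0 | by move=> k /ltnW; exact: above |].
move=> k; rewrite ltnS leq_eqVlt => /predU1P[->|/below //].
rewrite fA //; apply/eqP; rewrite eq_le xp /=.
by case: Xx => /(_ p) /andP[].
Qed.

Lemma slide_in_invlim x K n c : X x -> (forall k, (K < k)%N -> A (x k)) ->
  (K <= n)%N -> 0 <= c <= 1 -> X (slide f x n c).
Proof.
move=> [x01 xF] xA Kn c01; have cx01 := cx_itv x01 n c01.
split=> k; rewrite /slide.
  by case: leqP => // _; exact: iter_itv.
have [kn|kn|->] := ltngtP k n.
- by rewrite -(subnSK kn) /=; exact: selection.
- exact: xF.
rewrite subnn /=; apply: F_A_down (xF n) _; first exact: xA.
by have := x01 n; nra.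
Qed.

(** The arc is [descent f x] on [0, 2^-K]. *)
Lemma zero_joined x : X x -> x <> (fun=> 0) ->
  arc_joined R X (fun=> 0 : R) x.
Proof.
move=> Xx x0; have [K [xK xA x_below]] := descent_start Xx x0.
have x01 := Xx.1.
have x_gt0 k : (K <= k)%N -> 0 < x k.
  by rewrite leq_eqVlt => /predU1P[<-//|/xA]; exact: A_gt0.
have fx0 k : (K < k)%N -> f (x k) = 0 by move=> /xA; exact: fA.
have p0 : 0 < 2 ^+ K :> R by rewrite exprn_gt0.
have pK : 2 ^+ K * (2 ^+ K)^-1 = 1 :> R by rewrite divff ?gt_eqF.
have inK (t : R) : t <= (2 ^+ K)^-1 -> 2 ^+ K * t <= 1.
  move=> tK; apply: le_trans (_ : 2 ^+ K * (2 ^+ K)^-1 <= 1).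
    by rewrite ler_pM2l.
  by rewrite pK.
apply/arc_joinedP; first by apply: hausdorff_product => _; exact: Rhausdorff.
exists 0, (2 ^+ K)^-1, (descent f x); split.
- by rewrite invr_gt0.
- by apply: (descent_continuous f0 f_itv f_cont f_lt x01 fx0) => //; rewrite pK.
- move=> s t s0 st tK; apply: (descent_inj f0 x_gt0 fx0) => //.
  exact: inK.
- move=> t /andP[]; rewrite le_eqVlt => /predU1P[<- _|t0 tK].
    by rewrite descent0 //; exact: zero_in_invlim.
  have [n Kn [nt tn]] := dyadic_level t0 (inK _ tK).
  rewrite (descent_slide f0 fx0 Kn) //; last exact: ltW.
  exact: (slide_in_invlim Xx xA Kn (ramp_itv _ _)).
split; first exact: descent0.
rewrite (descent_slide f0 fx0 (leqnn K)) ?pK //; last first.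
  by rewrite exprS -mulrA pK; lra.
rewrite ramp1 ?pK //; apply/funext => k; rewrite /slide mul1r.
case: leqP => // /subnKC; move: (K - k)%N => j; elim: j k => [|j IH] k kK /=.
  by rewrite -kK addn0.
rewrite (IH k.+1); last by rewrite addSnnS.
by rewrite -x_below // -kK -addSnnS leq_addr.
Qed.

Lemma invlim_arcwise_connected : arcwise_connected R X.
Proof.
apply: (@arcwise_connected_from R {ptws nat -> R} X (fun=> 0)).
  by apply: hausdorff_product => _; exact: Rhausdorff.
move=> x Xx x0; apply: arc_joined_sym; last exact: zero_joined.
by apply: hausdorff_product => _; exact: Rhausdorff.
Qed.

End Inverse_limit.

(** * The set-valued map of a family of Cantor sets *)

Lemma cantor_setmap_notin (R : realType) (C : rat -> set R) (f : R -> R) t :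
  ~ C 0 t -> cantor_setmap C f t = [set f t].
Proof. by move=> nCt; rewrite /cantor_setmap; case: asboolP. Qed.

Lemma cantor_setmap_inP (R : realType) (C : rat -> set R) (f : R -> R) t y :
  C 0 t -> cantor_setmap C f t y <->
  0 <= y <= sup [set ratr r | r in [set r : rat | 0 <= r <= 1 /\ C r t]].
Proof. by move=> Ct; rewrite /cantor_setmap; case: asboolP. Qed.

Theorem corollary3p8 (R : realType) (C : rat -> set R) (f : R -> R)
  (C_cantor : forall r : rat, 0 <= r <= 1 -> cantor_set (C r))
  (C_pos : forall r : rat, 0 <= r <= 1 -> C r `<=` `]0, 1])
  (C_proper : forall r s : rat, 0 <= r <= 1 -> 0 <= s <= 1 -> s < r ->
     C r `<` C s)
  (C_endpoint : forall r s : rat, 0 <= r <= 1 -> 0 <= s <= 1 -> s < r ->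
     forall x : R, C r x -> ~ endpoint (C s) x)
  (f_itv : forall t : R, 0 <= t <= 1 -> 0 <= f t <= 1)
  (f_cont : {within `[0, 1], continuous f})
  (f_zero : forall t : R, ([set 0] `|` C 0) t -> f t = 0)
  (f_ltmin : exists2 m : R, is_min (C 0) m &
     forall t : R, 0 <= t <= 1 -> f t < m)
  (f_lt : forall t : R, 0 < t <= 1 -> f t < t) :
  arcwise_connected R (invlim01 (cantor_setmap C f)).
Proof.
have [m [_ m_lb] fm] := f_ltmin.
apply: (@invlim_arcwise_connected R f _ (C 0)) => //.
- by apply: f_zero; left.
- by move=> t /(C_pos 0); rewrite /= in_itv /= => /(_ isT)/andP[].
- by move=> s t s01 Ct; apply: lt_le_trans (m_lb _ Ct); exact: fm.
- by move=> t Ct; apply: f_zero; right.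
- exact: cantor_setmap_notin.
- move=> t Ct; apply/cantor_setmap_inP => //; rewrite lexx /=.
  apply: ub_le_sup; last by exists 0; rewrite ?rmorph0 //= lexx ler01.
  exists 1 => _ [r [/andP[_ r1] _] <-].
  by rewrite -(rmorph1 (@ratr R)) ler_rat.
move=> t y z Ct /(cantor_setmap_inP _ _ Ct)/andP[_ ysup] /andP[z0 zy].
by apply/cantor_setmap_inP => //; rewrite z0 (le_trans zy ysup).
Qed.
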